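(* Every Boolean control network that is Type-4 observable is also Type-1 observable. The converse is not true: there exists a Boolean control network that is Type-1 observable but not Type-4 observable.
   Context: A Boolean control network (BCN, in algebraic form) is given by positive integers $n,m,q$, with $N=2^n$, $M=2^m$, $Q=2^q$, and a system $x(t+1)=Lu(t)x(t)$, $y(t)=Hx(t)$, $t=0,1,2,\dots$, with states $x(t)\in\Delta_N$, inputs $u(t)\in\Delta_M$, outputs $y(t)\in\Delta_Q$. Here $\Delta_k$ is the set of columns of the identity matrix $I_k$; $L$ is an $N\times NM$ matrix with all columns in $\Delta_N$ and $H$ is a $Q\times N$ matrix with all columns in $\Delta_Q$. Products are semi-tensor products; concretely $Lux=L(u\otimes x)$ for $u\in\Delta_M$, $x\in\Delta_N$, with $\otimes$ the Kronecker product. For $x_0\in\Delta_N$, $p\ge 1$ and $U=u_0\cdots u_{p-1}\in(\Delta_M)^p$, put $x_{t+1}=Lu_tx_t$ for $0\le t<p$ and $(HL)_{x_0}^p(U)=(Hx_1)\cdots(Hx_p)\in(\Delta_Q)^p$. For an infinite input sequence $U=u_0u_1\cdots\in(\Delta_M)^{\mathbb{N}}$, put likewise $(HL)_{x_0}^{\mathbb{N}}(U)=(Hx_1)(Hx_2)\cdots\in(\Delta_Q)^{\mathbb{N}}$ with $x_{t+1}=Lu_tx_t$ for all $t\ge 0$. Type-1 observability: for every $x_0\in\Delta_N$ there exist $p\ge1$ and $U\in(\Delta_M)^p$ such that for all $\bar x_0\in\Delta_N$ with $\bar x_0\ne x_0$, $Hx_0=H\bar x_0$ implies $(HL)_{x_0}^p(U)\neq(HL)_{\bar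 x_0}^p(U)$. Type-4 observability: for any distinct $x_0,\bar x_0\in\Delta_N$ and any $U\in(\Delta_M)^{\mathbb{N}}$, $Hx_0=H\bar x_0$ implies $(HL)_{x_0}^{\mathbb{N}}(U)\neq(HL)_{\bar x_0}^{\mathbb{N}}(U)$. *)

(* Defs.v *)
From mathcomp Require Import all_boot all_order all_algebra.
From mathcomp.real_closed Require Import mxtens.

Set Implicit Arguments.
Unset Strict Implicit.
Unset Printing Implicit Defensive.

Import GRing.Theory.
Local Open Scope ring_scope.

(* All matrices involved have 0/1 entries, so they are taken over int. *)
Definition Delta (k : nat) : {pred 'cV[int]_k} :=
  [pred v : 'cV[int]_k | [exists j : 'I_k, v == col j 1%:M]].
Arguments Delta k : clear implicits.

(* The columns of L are indexed by 'I_(2 ^ m * 2 ^ n) so that L can be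
   multiplied by the Kronecker product u *t x, with u the left factor. *)
Record BCN := MkBCN {
  dimx : nat;
  dimu : nat;
  dimy : nat;
  dimx_gt0 : (0 < dimx)%N;
  dimu_gt0 : (0 < dimu)%N;
  dimy_gt0 : (0 < dimy)%N;
  bcnL : 'M[int]_(2 ^ dimx, 2 ^ dimu * 2 ^ dimx);
  bcnH : 'M[int]_(2 ^ dimy, 2 ^ dimx);
  bcnL_col : forall j, col j bcnL \in Delta (2 ^ dimx);
  bcnH_col : forall j, col j bcnH \in Delta (2 ^ dimy)
}.

Definition stateV (B : BCN) := 'cV[int]_(2 ^ dimx B).
Definition inputV (B : BCN) := 'cV[int]_(2 ^ dimu B).
Definition outputV (B : BCN) := 'cV[int]_(2 ^ dimy B).

(* u *t x has 1 * 1 columns, which is convertible to 1. *)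
Definition step (B : BCN) (x : stateV B) (u : inputV B) : stateV B :=
  bcnL B *m (u *t x : 'cV[int]_(2 ^ dimu B * 2 ^ dimx B)).

Definition output (B : BCN) (x : stateV B) : outputV B := bcnH B *m x.

(* scanl step x0 [:: u_0; ...; u_(p-1)] is [:: x_1; ...; x_p]: the initial
   state is not included. *)
Definition HLfin (B : BCN) (p : nat) (x0 : stateV B) (U : p.-tuple (inputV B)) :
    p.-tuple (outputV B) :=
  [tuple of map (@output B) (scanl (@step B) x0 U)].

Fixpoint state (B : BCN) (x0 : stateV B) (U : nat -> inputV B) (t : nat) :
    stateV B :=
  if t is t'.+1 then step (state x0 U t') (U t') else x0.

(* The output word starts with H x_1, hence the shift of the index. *)
Definition HLinf (B : BCN) (x0 : stateV B) (U : nat -> inputV B) :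
    nat -> outputV B :=
  fun t => output (state x0 U t.+1).

Definition type1_observable (B : BCN) : Prop :=
  forall x0 : stateV B, x0 \in Delta (2 ^ dimx B) ->
  exists (p : nat) (U : p.-tuple (inputV B)),
    [/\ (1 <= p)%N,
        {subset U <= Delta (2 ^ dimu B)} &
        forall xb : stateV B, xb \in Delta (2 ^ dimx B) -> xb != x0 ->
          output x0 = output xb -> HLfin x0 U != HLfin xb U].

(* Infinite output sequences are compared pointwise. *)
Definition type4_observable (B : BCN) : Prop :=
  forall x0 xb : stateV B,
    x0 \in Delta (2 ^ dimx B) -> xb \in Delta (2 ^ dimx B) -> x0 != xb ->
  forall U : nat -> inputV B, (forall t, U t \in Delta (2 ^ dimu B)) ->
    output x0 = output xb -> ~ (HLinf x0 U =1 HLinf xb U).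

(* Main.v *)
Require Import Defs.
From mathcomp Require Import all_boot all_order all_algebra.
From mathcomp.real_closed Require Import mxtens.
From Stdlib Require Import Classical.

(** A Type-4 observable network is distinguished by every input sequence, so
    any single infinite input, for instance a constant one, separates a given
    initial state from each other state with the same output after a finite
    time.  There are only finitely many states, hence these times are bounded, and a finite
    prefix of that input witnesses Type-1 observability
    ([type4_type1_observable]).

    For the failure of the converse, let the state be a pair of bits of which
    the first is observed.  One input moves the hidden bit to the observed
    position, so a single step with it determines the whole initial state.  The
    other input resets the state, so under it two initial states with the same
    first bit are never told apart.  Type-1 observability may choose the good
    input, while Type-4 observability must cope with the bad one.  The matrices
    of this network come from its transition and output functions
    ([bcn_of_fun]). *)

Set Implicit Arguments.
Unset Strict Implicit.
Unset Printing Implicit Defensive.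

Import GRing.Theory.
Local Open Scope ring_scope.

Lemma DeltaP k (v : 'cV[int]_k) :
  reflect (exists j, v = col j 1%:M) (v \in Delta k).
Proof. exact: 'exists_eqP. Qed.

Lemma col1_Delta k (j : 'I_k) : col j 1%:M \in Delta k.
Proof. by apply/DeltaP; exists j. Qed.

Lemma col1_inj k : injective (fun j : 'I_k => col j (1%:M : 'M[int]_k)).
Proof.
move=> i j /= /matrixP/(_ i 0); rewrite !mxE eqxx.
by case: eqP.
Qed.

Section Type4Type1.

Variable B : BCN.

Lemma foldl_step_mkseq (x0 : stateV B) (U : nat -> inputV B) t :
  foldl (@step B) x0 (mkseq U t) = state x0 U t.
Proof. by elim: t => // t IHt; rewrite mkseqS foldl_rcons IHt. Qed.

Lemma HLfin_mkseq (x0 : stateV B) (U : nat -> inputV B) p :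
  HLfin x0 [tuple of mkseq U p] = mkseq (HLinf x0 U) p :> seq _.
Proof.
change (map (@output B) (scanl (@step B) x0 (mkseq U p)) = mkseq (HLinf x0 U) p).
elim: p => // p IHp; rewrite (mkseqS (HLinf x0 U)) mkseqS scanl_rcons map_rcons.
by rewrite IHp -mkseqS foldl_step_mkseq.
Qed.

(** The state space is finite, so separation times chosen for the individual
    states [xb] have a maximum; one more than it is a common length, as output
    words are indexed from 0. *)
Lemma HLinf_separated (x0 : stateV B) (U : nat -> inputV B) :
    (forall xb : stateV B, xb \in Delta (2 ^ dimx B) -> xb != x0 ->
       output x0 = output xb -> ~ (HLinf x0 U =1 HLinf xb U)) ->
  exists2 p, (1 <= p)%N &
    forall xb : stateV B, xb \in Delta (2 ^ dimx B) -> xb != x0 ->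
      output x0 = output xb ->
      HLfin x0 [tuple of mkseq U p] != HLfin xb [tuple of mkseq U p].
Proof.
move=> sepU; pose e j : stateV B := col j 1%:M.
have /fin_all_exists[T sepT] j : exists t, e j != x0 ->
    output x0 = output (e j) -> HLinf x0 U t <> HLinf (e j) U t.
  case: (classic (e j != x0 /\ output x0 = output (e j))) => [[nj eqj]|nsep].
    have [t nt] := not_all_ex_not _ _ (sepU _ (col1_Delta j) nj eqj).
    by exists t.
  by exists 0%N => nj eqj; case: nsep.
exists (\max_j T j).+1 => // _ /DeltaP[j ->] nj eqj.
apply/eqP=> /(congr1 val) eqHL.
have ltT : (T j < (\max_i T i).+1)%N by rewrite ltnS leq_bigmax.
apply: (sepT j nj eqj).
rewrite -(nth_mkseq 0 (HLinf x0 U) ltT) -(nth_mkseq 0 (HLinf (e j) U) ltT).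
by rewrite -!HLfin_mkseq /= in eqHL *; rewrite eqHL.
Qed.

(** Any infinite input would do; the constant one at the first basis vector is
    available because there is at least one input. *)
Lemma type4_type1_observable : type4_observable B -> type1_observable B.
Proof.
move=> obs4 x0 x0D.
pose u : inputV B := col (Ordinal (expn_gt0 2 (dimu B))) 1%:M.
have uD : u \in Delta _ := col1_Delta _.
have [xb xbD nx eqx|p p_gt0 sepP] := @HLinf_separated x0 (fun=> u).
  by apply: obs4 => //; rewrite eq_sym.
exists p, [tuple of mkseq (fun=> u) p]; split=> // v.
by case/mapP=> i _ ->.
Qed.

End Type4Type1.

(** Matrices whose columns are basis vectors are those of functions between
    index sets, acting on indices of basis vectors. *)
Definition logical_mx k l (f : 'I_l -> 'I_k) : 'M[int]_(k, l) :=
  \matrix_(i, j) (i == f j)%:R.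

Lemma col_logical_mx k l (f : 'I_l -> 'I_k) j :
  col j (logical_mx f) = col (f j) 1%:M.
Proof. by apply/matrixP => i i0; rewrite !mxE. Qed.

Lemma col_logical_mx_Delta k l (f : 'I_l -> 'I_k) j :
  col j (logical_mx f) \in Delta k.
Proof. by rewrite col_logical_mx col1_Delta. Qed.

Lemma logical_mx_mul_col1 k l (f : 'I_l -> 'I_k) j :
  logical_mx f *m col j 1%:M = col (f j) 1%:M.
Proof. by rewrite colE mul1mx -colE col_logical_mx. Qed.

(** The Kronecker product of basis vectors is a basis vector, so that
    multiplying by it selects a column of the transition matrix. *)
Lemma tens_col1 k l (i : 'I_k) (j : 'I_l) :
  (col i 1%:M *t col j 1%:M : 'cV[int]_(k * l)) =
    col (mxtens_index (i, j)) 1%:M.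
Proof.
apply/matrixP => a b; rewrite !mxE -natrM mulnb; congr (nat_of_bool _)%:R.
case: a / mxtens_indexP => c d; rewrite mxtens_indexK /=.
by rewrite (can_eq (@mxtens_indexK _ _)).
Qed.

Section FunBCN.

Variables (n m q : nat) (n_gt0 : (0 < n)%N) (m_gt0 : (0 < m)%N).
Variables (q_gt0 : (0 < q)%N).
Variable trans : 'I_(2 ^ m) -> 'I_(2 ^ n) -> 'I_(2 ^ n).
Variable out : 'I_(2 ^ n) -> 'I_(2 ^ q).

Definition bcn_of_fun : BCN :=
  MkBCN n_gt0 m_gt0 q_gt0
    (col_logical_mx_Delta
      (fun k => let ux := mxtens_unindex k in trans ux.1 ux.2))
    (col_logical_mx_Delta out).

Lemma step_bcn_of_fun u x :
  @step bcn_of_fun (col x 1%:M) (col u 1%:M) = col (trans u x) 1%:M.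
Proof.
rewrite /step [X in _ *m X]tens_col1 [LHS]logical_mx_mul_col1.
by rewrite mxtens_indexK.
Qed.

Lemma output_bcn_of_fun x :
  @output bcn_of_fun (col x 1%:M) = col (out x) 1%:M.
Proof. exact: logical_mx_mul_col1. Qed.

End FunBCN.

(** The number [x < 4] encodes the pair of bits [(x./2, odd x)]; input 0 sends
    [(a, b)] to [(b, 0)] and input 1 sends it to [(0, 0)]. *)
Definition shift_or_reset (u : 'I_(2 ^ 1)) (x : 'I_(2 ^ 2)) : 'I_(2 ^ 2) :=
  if u == 0 :> nat then inord (odd x).*2 : 'I_4 else ord0 : 'I_4.

Definition first_bit (x : 'I_(2 ^ 2)) : 'I_(2 ^ 1) := inord x./2 : 'I_2.

Definition shift_reset_bcn : BCN :=
  @bcn_of_fun 2 1 1 isT isT isT shift_or_reset first_bit.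

Lemma first_bitE (x : 'I_(2 ^ 2)) : first_bit x = x./2 :> nat.
Proof. by rewrite inordK // ltn_half_double. Qed.

Lemma first_bit_shift (u : 'I_(2 ^ 1)) (x : 'I_(2 ^ 2)) :
  u = 0 :> nat -> first_bit (shift_or_reset u x) = odd x :> nat.
Proof.
move=> u0; rewrite first_bitE /shift_or_reset u0 inordK ?doubleK //.
by case: (odd x).
Qed.

(** The output of the initial state is its first bit, and the output after one
    step with input 0 is its second bit. *)
Lemma shift_reset_type1 : type1_observable shift_reset_bcn.
Proof.
move=> _ /DeltaP[j ->]; pose u : 'I_(2 ^ 1) := ord0 : 'I_2.
exists 1%N, [tuple (col u 1%:M : inputV shift_reset_bcn)]; split=> //.
  by move=> v; rewrite inE => /eqP ->; apply: col1_Delta.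
move=> _ /DeltaP[k ->] nkj.
rewrite !output_bcn_of_fun => /col1_inj eq_first.
apply: contra nkj => /eqP/(congr1 val)/= [].
rewrite !step_bcn_of_fun !output_bcn_of_fun => /col1_inj eq_second.
apply/eqP; congr (col _ _); apply: val_inj; rewrite /=.
rewrite -(odd_double_half k) -(odd_double_half j) -!first_bitE eq_first.
by rewrite -!(@first_bit_shift u) // eq_second.
Qed.

(** The states (0, 0) and (0, 1) have the same output and merge after one step
    with input 1. *)
Lemma shift_reset_not_type4 : ~ type4_observable shift_reset_bcn.
Proof.
pose r : 'I_(2 ^ 1) := ord_max : 'I_2.
pose a : 'I_(2 ^ 2) := @Ordinal 4 0 isT.
pose b : 'I_(2 ^ 2) := @Ordinal 4 1 isT.
move=> /(_ (col a 1%:M) (col b 1%:M) (col1_Delta a) (col1_Delta b)) obs4.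
apply: (obs4 _ (fun=> col r 1%:M)) => [|t||t].
- by apply/eqP => /col1_inj/(congr1 val).
- exact: col1_Delta.
- by rewrite !output_bcn_of_fun.
- congr (output _); elim: t => [|t IHt].
    by rewrite /= !step_bcn_of_fun.
  exact: (congr1 (fun x => @step shift_reset_bcn x (col r 1%:M)) IHt).
Qed.

Theorem mainTheorem13 :
  (forall B : BCN, type4_observable B -> type1_observable B) /\
  (exists B : BCN, type1_observable B /\ ~ type4_observable B).
Proof.
split; first exact: type4_type1_observable.
exists shift_reset_bcn.
by split; [apply: shift_reset_type1 | apply: shift_reset_not_type4].
Qed.
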